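(* Let $d$ be a positive integer, let $k\in\{1,\ldots,d\}$, and set $h(k,d)=\max\{d+1,\,2(k+1)\}$. Let $A\subset\mathbb{R}^d$ be a finite set, and assume that $\dim \operatorname{lpos} B\le k$ for every $B\subset A$ with $|B|\le h(k,d)$. Then $\dim\operatorname{lpos} A\le k$.
   Context: For a finite set $A=\{a_1,\ldots,a_n\}\subset\mathbb{R}^d$, its cone hull is $\operatorname{pos} A=\{\sum_{i=1}^n\alpha_i a_i:\ \alpha_i\ge 0 \text{ for all } i\in\{1,\ldots,n\}\}$. The lineality space of $\operatorname{pos} A$ is $\operatorname{lpos} A=\operatorname{pos} A\cap(-\operatorname{pos} A)$, which is a linear subspace of $\mathbb{R}^d$; $\dim$ denotes its linear dimension. *)

(* Defs.v *)
From HB Require Import structures.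
From mathcomp Require Import all_boot all_order all_algebra finmap.
From mathcomp Require Import mathcomp_extra boolp classical_sets reals.
Set Implicit Arguments.
Unset Strict Implicit.
Unset Printing Implicit Defensive.
Import Order.TTheory GRing.Theory Num.Theory.
Local Open Scope classical_set_scope.
Local Open Scope ring_scope.

Definition pos (R : realType) (d : nat) (A : {fset 'rV[R]_d}) : set 'rV[R]_d :=
  [set x | exists2 alpha : 'rV[R]_d -> R,
     (forall a, a \in A -> 0 <= alpha a) & x = \sum_(a <- A) alpha a *: a].

Definition lpos (R : realType) (d : nat) (A : {fset 'rV[R]_d}) : set 'rV[R]_d :=
  pos A `&` (-%R @` pos A).

Section LinearitySpace.
Variables (R : realType) (d : nat) (A : {fset 'rV[R]_d}).

Lemma pos0 : pos A 0.
Proof.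
exists (fun=> 0) => [a _|]; first exact: lexx.
by rewrite big1 // => a _; rewrite scale0r.
Qed.

Lemma posD x y : pos A x -> pos A y -> pos A (x + y).
Proof.
move=> [f f0 ->] [g g0 ->]; exists (fun a => f a + g a) => [a aA|].
  by rewrite addr_ge0 ?f0 ?g0.
by rewrite -big_split /=; apply: eq_bigr => a _; rewrite scalerDl.
Qed.

Lemma posZ c x : 0 <= c -> pos A x -> pos A (c *: x).
Proof.
move=> c0 [f f0 ->]; exists (fun a => c * f a) => [a aA|].
  by rewrite mulr_ge0 ?f0.
by rewrite scaler_sumr; apply: eq_bigr => a _; rewrite scalerA.
Qed.

Lemma lposE x : lpos A x <-> pos A x /\ pos A (- x).
Proof.
split=> [[px [y py yx]]|[px pNx]]; first by split=> //; rewrite -yx opprK.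
by split=> //; exists (- x) => //; rewrite opprK.
Qed.

Lemma lpos0 : lpos A 0.
Proof. by apply/lposE; rewrite oppr0; split; exact: pos0. Qed.

Lemma lposD x y : lpos A x -> lpos A y -> lpos A (x + y).
Proof.
move=> /lposE[px nx] /lposE[py ny]; apply/lposE.
by rewrite opprD; split; apply: posD.
Qed.

Lemma lposZ c x : lpos A x -> lpos A (c *: x).
Proof.
move=> /lposE[px nx]; apply/lposE.
have [c0|/ltW c0] := leP 0 c; first by rewrite -scalerN; split; apply: posZ.
have Nc0 : 0 <= - c by rewrite oppr_ge0.
split; last by rewrite -scaleNr; apply: posZ.
by rewrite -[c *: x]opprK -scaleNr -scalerN; apply: posZ.
Qed.

Lemma lpos_vspace_subproof :
  exists V : {vspace 'rV[R]_d}, [set x | x \in V] = lpos A.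
Proof.
pose P n := `[< exists2 V : {vspace 'rV[R]_d},
                  [set x | x \in V] `<=` lpos A & \dim V = n >].
have exP : exists n, P n.
  exists 0%N; apply/asboolP; exists 0%VS; last exact: dimv0.
  by move=> x /=; rewrite memv0 => /eqP ->; exact: lpos0.
have ubP n : P n -> (n <= \dim {: 'rV[R]_d})%N.
  by move=> /asboolP[V _ <-]; apply/dimvS/subvf.
case: (ex_maxnP exP ubP) => n /asboolP[V VA dimV] maxn.
exists V; apply/seteqP; split=> // x Ax /=.
suff /eqP -> : V == (V + <[x]>)%VS by apply: (subvP (addvSr V _)); exact: memv_line.
rewrite eqEdim addvSl /= dimV; apply: maxn; apply/asboolP.
exists (V + <[x]>)%VS => // y /= /memv_addP[v vV [w /vlineP[c ->] ->]].
by apply: lposD; [exact: VA | exact: lposZ].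
Qed.

Definition lpos_vspace : {vspace 'rV[R]_d} := sval (cid lpos_vspace_subproof).

Lemma lpos_vspaceE : [set x | x \in lpos_vspace] = lpos A.
Proof. exact: svalP (cid lpos_vspace_subproof). Qed.

End LinearitySpace.

Definition dim_lpos (R : realType) (d : nat) (A : {fset 'rV[R]_d}) : nat :=
  \dim (lpos_vspace A).

Definition h (k d : nat) : nat := maxn (d + 1)%N (2 * (k + 1))%N.

(* Main.v *)
Require Import Defs.
From mathcomp Require Import all_boot all_order all_algebra finmap.
From mathcomp Require Import boolp reals.
From mathcomp Require Import zify lra.
Import Order.TTheory GRing.Theory Num.Theory.
Set Implicit Arguments.
Unset Strict Implicit.
Unset Printing Implicit Defensive.

(** Suppose [dim_lpos A] exceeds [k], and let [B] be a subset of [A] of least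
    cardinality with this property; the point is to bound [n], the number of
    elements of [B].

    By minimality [B] consists of vectors [b] such that [- b] is also in
    [pos B] ([lpos_dependent_part]), so [B] carries a linear dependency with
    positive coefficients ([positive_dependency]).  Let [D] be the space of
    linear dependencies of [B] and [g] its dimension; then [pos B = lpos B] has
    dimension [m = n - g], with [k < m <= d].

    The nonnegative vectors of [D] form a pointed cone with nonempty relative
    interior, whose faces are described by the zero sets of its elements (this
    is Gale duality: [D] carries the Gale diagram of [B]).  A nonempty zero set
    [F] is the complement of a proper subset of [B] on which a positive
    dependency lives.  That subset positively spans a linear space, which has
    dimension at most [k] by minimality; rank-nullity turns this into
    [#|F| >= m - k + 1].

    Intersections of zero sets are zero sets, so the minimal nonempty ones are
    pairwise disjoint ([trivIset_min_faces]); they correspond to the facets of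
    the cone, and a pointed cone of dimension [g] has at least [g] facets
    ([dim_le_card_min_faces]).  Therefore [n >= g * (m - k + 1)].  If [g <= 1]
    then [n = m + g <= d + 1]; if [g >= 2], then with [c = m - k >= 1]
    [[
      g (c + 1) - 2 (g + c - 1) = (g - 2) (c - 1) >= 0,
    ]]
    so [n >= 2 (g + c - 1)], which rearranges to
    [n <= 2 (n - g - c + 1) = 2 (k + 1)]. *)

(** * Zero sets of nonnegative vectors in a coordinate subspace *)

Section Coordinates.
Local Open Scope ring_scope.

(** The matrix selects the coordinates in [X]; presenting the space as a kernel
    makes its dimension accessible to rank-nullity. *)
Definition vanishing (K : fieldType) (n : nat) (X : {set 'I_n}) :
    {vspace 'rV[K]_n} :=
  lker (linfun (mulmxr
    (\matrix_(i < n, j < #|X|) (i == enum_val j)%:R : 'M[K]_(n, #|X|)))).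

Lemma vanishingP (K : fieldType) n (X : {set 'I_n}) (u : 'rV[K]_n) :
  reflect (forall i, i \in X -> u 0 i = 0) (u \in vanishing K X).
Proof.
have colE j : (u *m \matrix_(i, j) (i == enum_val j)%:R) 0 j = u 0 (@enum_val _ (mem X) j).
  rewrite !mxE (bigD1 (enum_val j)) //= !mxE eqxx mulr1 big1 ?addr0 // => i /negbTE ij.
  by rewrite !mxE ij mulr0.
rewrite /vanishing memv_ker lfunE /=; apply: (iffP eqP) => [u0 i iX|u0].
  have := colE (enum_rank_in iX i).
  by rewrite u0 mxE enum_rankK_in.
by apply/rowP => j; rewrite colE u0 ?mxE // enum_valP.
Qed.

Lemma dim_vanishing (K : fieldType) n (X : {set 'I_n}) :
  (n <= \dim (vanishing K X) + #|X|)%N.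
Proof.
rewrite /vanishing; set f := linfun _.
have := limg_ker_dim f fullv; rewrite capfv dimvf => Hn.
have := dimvS (subvf (f @: fullv)%VS); rewrite dimvf.
by rewrite -[X in (X <= _ + _)%N]mul1n -[(1 * n)%N]Hn /dim /= mul1n leq_add2l.
Qed.

Variables (R : realFieldType) (n : nat) (D : {vspace 'rV[R]_n}) (p : 'rV[R]_n).
Hypotheses (pD : p \in D) (p_gt0 : forall i, 0 < p 0 i).

Definition zeros (u : 'rV[R]_n) : {set 'I_n} := [set i | u 0 i == 0].

(** A face of the cone of nonnegative vectors of [D] is recorded by the
    coordinates that vanish on its relative interior; [F != set0] leaves out
    the whole cone, so that the minimal sets are the facets. *)
Definition is_face (F : {set 'I_n}) : bool :=
  (F != finset.set0) &&
  `[< exists u, [/\ u \in D, forall i, 0 <= u 0 i & F = zeros u] >].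

Definition min_faces : {set {set 'I_n}} := [set F | minset is_face F].

(** Adding two nonnegative vectors intersects their zero sets, so two minimal
    zero sets that meet both equal their intersection. *)
Lemma trivIset_min_faces : finset.trivIset min_faces.
Proof.
apply/finset.trivIsetP => F G; rewrite !inE.
move=> /minsetP[/andP[F0 /asboolP[u [uD u0 eF]]] minF].
move=> /minsetP[/andP[G0 /asboolP[v [vD v0 eG]]] minG] FG.
rewrite -setI_eq0; apply: contraR FG => FG0.
have faceI : is_face (F :&: G).
  rewrite /is_face FG0 /=; apply/asboolP; exists (u + v); split.
  - exact: memvD.
  - by move=> i; rewrite mxE addr_ge0.
  - by apply/finset.setP => i; rewrite eF eG !inE mxE paddr_eq0.
rewrite -(minF _ faceI (finset.subsetIl _ _)).
by apply/eqP/minG; rewrite ?finset.subsetIr.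
Qed.

(** Leave the interior point [p] in the direction [u]: where the boundary of
    the orthant is first met, the coordinates that vanish are ones along which
    [u] decreases. *)
Lemma face_below (u : 'rV[R]_n) l : u \in D -> u 0 l < 0 ->
  exists2 F, F \in min_faces & forall i, i \in F -> u 0 i != 0.
Proof.
move=> uD ul.
(* [p 0 i / - u 0 i] is the time at which coordinate [i] reaches zero. *)
case: (@Order.TotalTheory.arg_minP _ _ _ l (fun i => u 0 i < 0)
  (fun i => p 0 i / - u 0 i)) => // m um minm.
pose w := p + (p 0 m / - u 0 m) *: u.
have t_gt0 : 0 < p 0 m / - u 0 m by rewrite divr_gt0 ?oppr_gt0.
have face_w : is_face (zeros w).
  apply/andP; split.
    apply/set0Pn; exists m.
    rewrite inE !mxE invrN mulrN mulNr -mulrA mulVf ?mulr1 ?subrr //.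
    by rewrite lt_eqF.
  apply/asboolP; exists w; split=> // [|i].
    by rewrite memvD // memvZ.
  rewrite !mxE; have [ui|ui] := ltP (u 0 i) 0.
    have := minm _ ui; rewrite ler_pdivlMr ?oppr_gt0 // mulrN; lra.
  by apply: addr_ge0; [exact: ltW | apply: mulr_ge0 => //; exact: ltW].
have [F minF Fw] := minset_exists face_w.
exists F; first by rewrite inE.
move=> i /(fintype.subsetP Fw); rewrite inE !mxE; apply: contraTneq => ->.
by rewrite mulr0 addr0 gt_eqF.
Qed.

(** Pick one coordinate in each minimal zero set.  By [face_below], a vector of
    [D] that vanishes at all of them has no negative coordinate, and neither
    does its opposite, so it is zero: these coordinates separate the points
    of [D], and there are at least [\dim D] of them. *)
Lemma dim_le_card_min_faces : (\dim D <= #|min_faces|)%N.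
Proof.
have Ppart : finset.partition min_faces (cover min_faces).
  rewrite /finset.partition eqxx trivIset_min_faces /=.
  by rewrite inE; apply/minsetP => -[/andP[]]; rewrite eqxx.
have trX := transversalP Ppart; rewrite -(card_transversal trX).
set X := transversal _ _ in trX *.
have nonneg u : u \in D -> u \in vanishing R X -> forall i, 0 <= u 0 i.
  move=> uD /vanishingP uX l; have [ul|//] := ltP (u 0 l) 0.
  have [F FP uF] := face_below uD ul.
  have /and3P[_ _ /forall_inP/(_ _ FP)] := trX.
  move=> /finset.cards1P[i XFi].
  have /setIP[iX iF] : i \in (X :&: F) by rewrite XFi finset.set11.
  by have := uF _ iF; rewrite uX ?eqxx.
have capD : (D :&: vanishing R X)%VS = 0%VS.
  apply/eqP; rewrite -subv0; apply/subvP => u /memv_capP[uD uX].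
  rewrite memv0; apply/eqP/rowP => i; apply/eqP; rewrite mxE eq_le nonneg // andbT.
  by have := nonneg (- u); rewrite !rpredN => /(_ uD uX i); rewrite mxE oppr_ge0.
have := dimv_sum_cap D (vanishing R X); rewrite capD dimv0 addn0 => dimDX.
have := dim_vanishing R X; have := dimvS (subvf (D + vanishing R X)).
rewrite dimvf /dim /=; lia.
Qed.

End Coordinates.

(** * Lineality spaces and positive dependencies *)

Section Cones.
Local Open Scope ring_scope.
Variables (R : realType) (d : nat).
Implicit Types (A B C S : {fset 'rV[R]_d}).

Lemma pos_mem A a : a \in A -> pos A a.
Proof.
move=> aA; exists (fun b => (b == a)%:R) => [b _|]; first exact: ler0n.
rewrite (big_fsetD1 a) //= eqxx scale1r big1_fset ?addr0 // => b.
by rewrite !inE => /andP[/negbTE -> _] _; rewrite scale0r.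
Qed.

Lemma pos_sum A (I : eqType) (r : seq I) (P : pred I) (v : I -> 'rV[R]_d) :
  (forall i, i \in r -> P i -> pos A (v i)) -> pos A (\sum_(i <- r | P i) v i).
Proof.
move=> Av; rewrite big_seq_cond; apply: (big_ind (pos A)); first exact: pos0.
  by move=> x y; exact: posD.
by move=> i /andP[]; exact: Av.
Qed.

(** A nonnegative dependency can be solved for minus any of the vectors that it
    really involves. *)
Lemma pos_opp_dependency C (I : eqType) (r : seq I) (c : I -> R)
    (v : I -> 'rV[R]_d) i :
    uniq r -> (forall j, j \in r -> 0 <= c j) ->
    (forall j, j \in r -> 0 < c j -> v j \in C) ->
    \sum_(j <- r) c j *: v j = 0 -> i \in r -> 0 < c i ->
  pos C (- v i).
Proof.
move=> ur c0 vC dep ir ci.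
have -> : - v i = (c i)^-1 *: \sum_(j <- r | j != i) c j *: v j.
  move: dep; rewrite (bigD1_seq i) //= => /eqP.
  rewrite addrC addr_eq0 => /eqP ->.
  by rewrite scalerN scalerA mulVf ?scale1r // gt_eqF.
apply: posZ; first by rewrite invr_ge0 ltW.
apply: pos_sum => j jr _; have := c0 j jr; rewrite le_eqVlt => /orP[/eqP <-|cj].
  by rewrite scale0r; exact: pos0.
by apply: posZ; [exact: ltW | exact/pos_mem/vC].
Qed.

Lemma mem_lpos_vspace A x : (x \in lpos_vspace A) <-> lpos A x.
Proof. by rewrite -lpos_vspaceE. Qed.

(** Adding representations of [x] and [- x] gives a nonnegative dependency, so
    by [pos_opp_dependency] they only use vectors whose opposites lie in
    [pos B]: the other vectors of [B] can be discarded without changing the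
    lineality space. *)
Lemma lpos_dependent_part B x :
  lpos B x -> lpos [fset a in B | `[< pos B (- a) >]]%fset x.
Proof.
set S := [fset a in B | _]%fset.
suff sub y : lpos B y -> pos S y.
  move=> /lposE[Bx BNx]; apply/lposE.
  by split; apply: sub; apply/lposE; rewrite ?opprK.
move=> /lposE[[a a0 ya] [b b0 yb]].
exists a => [c|]; first by rewrite !inE => /andP[/a0].
rewrite ya; apply/esym/big_fset_incl.
  by apply/fsubsetP => c; rewrite !inE => /andP[].
move=> c cB; rewrite !inE cB /= => cS.
suff -> : a c = 0 by rewrite scale0r.
apply/eqP; rewrite eq_le a0 // andbT leNgt; apply/negP => ac.
case/negP: cS; apply/asboolP.
apply: (@pos_opp_dependency B _ B (fun e => a e + b e) id) => //.
- by move=> e eB; rewrite addr_ge0 ?a0 ?b0.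
- under eq_bigr do rewrite scalerDl.
  by rewrite big_split /= -ya -yb subrr.
- by rewrite ltr_pwDl ?b0.
Qed.

(** Sum the trivial relations [a + (- a) = 0] over [a \in B], with each [- a]
    expanded in [pos B]: every coefficient is then at least [1]. *)
Lemma positive_dependency B : (forall a, a \in B -> pos B (- a)) ->
  exists2 c : 'rV[R]_d -> R,
    forall a, a \in B -> 0 < c a & \sum_(a <- B) c a *: a = 0.
Proof.
move=> BN.
have /choice[e eP] : forall a, exists e : 'rV[R]_d -> R, a \in B ->
    (forall b, b \in B -> 0 <= e b) /\ - a = \sum_(b <- B) e b *: b.
  move=> a; case: (boolP (a \in B)) => [/BN[e e0 ae]|aB]; first by exists e.
  by exists (fun=> 0).
exists (fun b => 1 + \sum_(a <- B) e a b) => [b bB|].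
  rewrite ltr_pwDl // big_seq; apply: sumr_ge0 => a aB.
  by have [+ _] := eP a aB; exact.
under eq_bigr do rewrite scalerDl scale1r scaler_suml.
rewrite big_split /= exchange_big /= -big_split /= big_seq big1 // => a aB.
by have [_ <-] := eP a aB; rewrite subrr.
Qed.

Lemma dim_lpos_le S B :
  (forall x, lpos S x -> lpos B x) -> (dim_lpos S <= dim_lpos B)%N.
Proof.
by move=> SB; apply/dimvS/subvP => x /mem_lpos_vspace/SB/mem_lpos_vspace.
Qed.

(** * Cardinality of minimal configurations *)

(** The dependencies of [B] form the kernel [D] of the coordinate map [f]; the
    bound comes from counting the coordinates in the minimal zero sets
    of [D], each of which is large by minimality of [B]. *)
Lemma card_minimal_lpos k B :
    (k < dim_lpos B)%N -> (forall C, (C `<` B)%fset -> (dim_lpos C <= k)%N) ->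
  (#|` B| <= h k d)%N.
Proof.
move=> kB minB.
have BN a : a \in B -> pos B (- a).
  pose S := [fset b in B | `[< pos B (- b) >]]%fset.
  have : S = B.
    have SB : (S `<=` B)%fset by apply/fsubsetP => b; rewrite !inE => /andP[].
    apply/eqP.
    apply: contraLR kB; rewrite -leqNgt => neSB.
    apply: leq_trans (minB S _); last by rewrite fproperEneq neSB.
    by apply: dim_lpos_le => x; exact: lpos_dependent_part.
  by move=> /fsetP /(_ a) + aB; rewrite !inE aB => /asboolP.
have [c c_gt0 depc] := positive_dependency BN.
set n := #|` B|; pose v (i : 'I_n) : 'rV[R]_d := nth 0 (enum_fset B) i.
have vB i : v i \in B by exact: mem_nth.
have v_inj : injective v.
  by move=> i j /eqP; rewrite nth_uniq ?fset_uniq // => /eqP; exact: val_inj.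
have sumB (F : 'rV[R]_d -> 'rV[R]_d) : \sum_(a <- B) F a = \sum_(i < n) F (v i).
  by rewrite (big_nth 0) big_mkord.
pose f := linfun (mulmxr (\matrix_(i < n) v i) : 'rV[R]_n -> 'rV[R]_d).
have fE u : f u = \sum_i u 0 i *: v i.
  by rewrite lfunE /= mulmx_sum_row; apply: eq_bigr => i _; rewrite rowK.
pose D := lker f; pose p : 'rV[R]_n := \row_i c (v i).
have pD : p \in D.
  by rewrite memv_ker fE; under eq_bigr do rewrite mxE; rewrite -(sumB (fun a => c a *: a)) depc.
have p_gt0 i : 0 < p 0 i by rewrite mxE c_gt0.
have dimB : (dim_lpos B <= \dim (limg f))%N.
  apply/dimvS/subvP => x /mem_lpos_vspace/lposE[[a _ ->] _].
  suff -> : \sum_(b <- B) a b *: b = f (\row_i a (v i)) by rewrite memv_img ?memvf.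
  by rewrite sumB fE; apply: eq_bigr => i _; rewrite mxE.
have dimf : (\dim D + \dim (limg f) = n)%N.
  by have := limg_ker_dim f fullv; rewrite capfv dimvf /dim /= mul1n.
have dim_img : (\dim (limg f) <= d)%N.
  by have := dimvS (subvf (limg f)); rewrite dimvf /dim /= mul1n.
have card_face F : F \in min_faces D -> (n < k + \dim D + #|F|)%N.
  rewrite inE => /minsetP[/andP[/set0Pn[i0 i0F] /asboolP[u [uD u_ge0 eF]]] _].
  (* [u] restricts to a positive dependency on [C], so that [pos C] is linear. *)
  pose C := [fset v i | i in 'I_n & i \notin F]%fset.
  have vC i : (v i \in C) = (i \notin F).
    apply/imfsetP/idP => [[j /=]|iF]; last by exists i.
    by rewrite inE => jF /v_inj ->.
  have CB : (C `<` B)%fset.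
    rewrite fproperE; apply/andP; split; first by apply/fsubsetP => a /imfsetP[i _ ->].
    by apply/negP => /fsubsetP/(_ _ (vB i0)); rewrite vC i0F.
  have lposC i : i \notin F -> v i \in lpos_vspace C.
    move=> iF; apply/mem_lpos_vspace/lposE; split; first by apply: pos_mem; rewrite vC.
    apply: (@pos_opp_dependency C _ (index_enum 'I_n) (u 0)) => //.
    - exact: index_enum_uniq.
    - by move=> j _ uj; rewrite vC eF inE gt_eqF.
    - by apply/eqP; rewrite -fE -memv_ker.
    - by move: iF; rewrite lt_neqAle u_ge0 andbT eq_sym eF inE.
  have dimC : (\dim (f @: vanishing R F) <= k)%N.
    apply: leq_trans (minB _ CB); apply/dimvS/subvP => x.
    move=> /memv_imgP[w /vanishingP wF ->]; rewrite fE; apply: memv_suml => i _.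
    case: (boolP (i \in F)) => [/wF ->|/lposC vi].
      by rewrite scale0r mem0v.
    exact: memvZ.
  (* The positive dependency [p] vanishes nowhere, in particular not on [F]. *)
  have dim_lt : (\dim (vanishing R F :&: D) < \dim D)%N.
    rewrite ltnNge; apply/negP => le.
    have : (vanishing R F :&: D == D)%VS by rewrite eqEdim capvSr.
    move=> /eqP/vspaceP/(_ p); rewrite memv_cap pD andbT => /vanishingP/(_ _ i0F) p0.
    by have := p_gt0 i0; rewrite p0 ltxx.
  apply: leq_ltn_trans (dim_vanishing R F) _; rewrite -(limg_ker_dim f (vanishing R F)).
  by rewrite ltn_add2r addnC -addnS leq_add.
have card_cover : (\sum_(F in min_faces D) #|F| <= n)%N.
  have /eqP -> := trivIset_min_faces D.
  by apply: leq_trans (max_card _) _; rewrite card_ord.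
have := dim_le_card_min_faces pD p_gt0.
have : (#|min_faces D| * (n.+1 - k - \dim D) <= n)%N.
  apply: leq_trans card_cover; rewrite -sum_nat_const leq_sum // => F /card_face; lia.
move: kB dimB dimf dim_img; rewrite /h.
move: (dim_lpos B) (\dim (limg f)) (\dim D) #|min_faces D|.
move=> q m g t kq qm gm md tn gt.
have gn : (g * (m - k).+1 <= n)%N.
  apply: leq_trans tn; apply: leq_mul => //; lia.
move: gn; case: g gm {gt tn} => [|[|g]] gm; [lia | lia | move=> gn].
(* With two or more facets it is the bound [2 * (k + 1)] that holds. *)
rewrite leq_max; apply/orP; right; nia.
Qed.

End Cones.

Theorem theorem2p1 (R : realType) (d k : nat) (hd : (0 < d)%N)
    (hk : (1 <= k <= d)%N) (A : {fset 'rV[R]_d})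
    (hA : forall B : {fset 'rV[R]_d},
        (B `<=` A)%fset -> (#|` B| <= h k d)%N -> (dim_lpos B <= k)%N) :
  (dim_lpos A <= k)%N.
Proof.
rewrite leqNgt; apply/negP => kA.
pose P n := `[< exists B : {fset 'rV[R]_d},
  [/\ (B `<=` A)%fset, (k < dim_lpos B)%N & #|` B| = n] >].
have exP : exists n, P n by exists #|` A|; apply/asboolP; exists A.
case: (ex_minnP exP) => n /asboolP[B [BA kB cardB]] minn.
suff cardB_le : (#|` B| <= h k d)%N.
  by have := hA B BA cardB_le; rewrite leqNgt kB.
apply: card_minimal_lpos kB _ => C CB; rewrite leqNgt; apply/negP => kC.
have := fproper_ltn_card CB; rewrite cardB ltnNge => /negP; apply.
apply: minn; apply/asboolP; exists C; split=> //.
exact: fsubset_trans (fproper_sub CB) BA.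
Qed.
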